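(* Let $G=(V,E)$ be a finite simple graph with $|V|\ge \gamma(G)+2$. If $b(\mathcal{MB}(G))\le 2$, then $Sb_2(G)=b(G)+b(\mathcal{MB}(G))$.
   Context: For a graph $G=(V,E)$, $\gamma(G)$ is its domination number: the minimum size of a set $D\subseteq V$ such that every vertex is in $D$ or adjacent to a vertex of $D$. The bondage number $b(G)$ is the minimum size of a set $\mathcal{E}\subseteq E$ with $\gamma(G-\mathcal{E})>\gamma(G)$; such a set of minimum size is a minimum bondage set. For a positive integer $k$, $Sb_k(G)$ (the $k$-synchronous bondage number) is the minimum size of a set $\mathcal{E}\subseteq E$ with $\gamma(G-\mathcal{E})=\gamma(G)+k$. $\mathcal{MB}(G)$ denotes the set of all graphs $G-\mathcal{E}$ where $\mathcal{E}$ is a minimum bondage set of $G$, and for a set of graphs $\mathcal{G}$, $b(\mathcal{G})=\min\{b(G'):G'\in\mathcal{G}\}$. *)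

(* Defs.v *)
From HB Require Import structures.
From mathcomp Require Import all_boot.

Set Implicit Arguments.
Unset Strict Implicit.
Unset Printing Implicit Defensive.

(* A simple graph with vertex set the finite type V; an edge is the *)
(* two-element set of its endpoints. *)
Record sgraph (V : finType) := SGraph {
  edges : {set {set V}};
  edges_card2 : [forall e in edges, #|e| == 2]
}.

HB.instance Definition _ (V : finType) := [isSub for @edges V].
HB.instance Definition _ (V : finType) := [Finite of sgraph V by <:].

(* The minimum of a finite collection of numbers; None (read as +oo) if it is *)
(* empty. *)
Definition omin (s : seq nat) : option nat :=
  if s is x :: s' then Some (foldr minn x s') else None.

Lemma ominP (s : seq nat) (m : nat) :
  omin s = Some m <-> m \in s /\ (forall x, x \in s -> m <= x).
Proof.
have minP x t : foldr minn x t \in x :: t /\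
    (forall y, y \in x :: t -> foldr minn x t <= y).
  elim: t => [|z t [IHin IHle]] /=.
    by rewrite mem_head; split=> // y; rewrite inE => /eqP->.
  split.
    case: leqP => _; first by rewrite !inE eqxx orbT.
    by move: IHin; rewrite !inE => /orP[->|->]; rewrite ?orbT.
  move=> y; rewrite !inE => /or3P[/eqP->|/eqP->|yt].
  - by rewrite geq_min IHle ?mem_head ?orbT.
  - by rewrite geq_minl.
  - by rewrite geq_min IHle ?inE ?yt ?orbT.
case: s => [|x t] /=; first by split=> [|[]].
have [inm lem] := minP x t; split=> [[<-]|[min_ lem']] //.
by congr Some; apply/eqP; rewrite eqn_leq lem // lem'.
Qed.

Section Bondage.
Variable V : finType.
Implicit Types (G : sgraph V) (D : {set V}) (F : {set {set V}}).

Definition adj G (u v : V) : bool := [set u; v] \in edges G.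

Definition dominating G D : bool :=
  [forall v, (v \in D) || [exists u in D, adj G u v]].

(* The whole vertex set is dominating, so the minimum is always attained. *)
Definition domination_number G : nat :=
  #|[arg min_(D < [set: V] | dominating G D) #|D|]|.

Lemma del_edges_subproof G F : [forall e in edges G :\: F, #|e| == 2].
Proof.
apply/forall_inP => e; rewrite inE => /andP[_ eG].
exact: (forall_inP (edges_card2 G)).
Qed.

Definition del_edges G F : sgraph V := SGraph (del_edges_subproof G F).

Definition bondage_set G F : bool :=
  (F \subset edges G) &&
  (domination_number G < domination_number (del_edges G F)).

Definition bondage_number G : option nat :=
  omin [seq #|F| | F in [set F | bondage_set G F]].

Definition min_bondage_set G F : bool :=
  bondage_set G F && (bondage_number G == Some #|F|).

Definition sync_bondage_number (k : nat) G : option nat :=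
  omin [seq #|F| | F in
    [set F : {set {set V}} | (F \subset edges G) &&
       (domination_number (del_edges G F) == domination_number G + k)]].

Definition MB G : {set sgraph V} :=
  [set del_edges G F | F in [set F | min_bondage_set G F]].

(* Graphs without a bondage set (bondage number +oo) do not contribute. *)
Definition class_bondage_number (C : {set sgraph V}) : option nat :=
  omin (pmap bondage_number (enum C)).

End Bondage.

(* Main.v *)
Require Import Defs.
From HB Require Import structures.
From mathcomp Require Import all_boot.

(** Deleting one edge raises the domination number by at most one, so deleting
a minimum bondage set raises it by exactly one. Upper bound: a minimum bondage
set of [G], followed by a minimum bondage set of the best graph in [MB G],
raises it by exactly two. Lower bound: if deleting [F] raises it by two, then
deleting [F] minus any one edge [e] raises it by at least one, whence
[#|F| > b]; if moreover [#|F| = b + 1], then [F] minus [e] is a minimum bondage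
set and [e] alone is a bondage set of the remaining graph, so [c <= 1]. *)

Section Bondage.
Set Implicit Arguments.
Unset Strict Implicit.
Variable V : finType.
Implicit Types (G : sgraph V) (D : {set V}) (F : {set {set V}}).

Lemma domination_number_le G D : dominating G D -> domination_number G <= #|D|.
Proof.
rewrite /domination_number; case: arg_minnP => [|D0 _ minD0 domD].
  by apply/forallP => v; rewrite inE.
exact: minD0.
Qed.

Lemma domination_number_attained G :
  exists2 D, dominating G D & #|D| = domination_number G.
Proof.
rewrite /domination_number; case: arg_minnP => [|D domD _]; last by exists D.
by apply/forallP => v; rewrite inE.
Qed.

Lemma del_edgesU G F1 F2 :
  del_edges (del_edges G F1) F2 = del_edges G (F1 :|: F2).
Proof. by apply: val_inj; rewrite /= setDDl. Qed.

Lemma del_edges0 G : del_edges G set0 = G.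
Proof. by apply: val_inj; rewrite /= setD0. Qed.

(** A minimum dominating set of [G], enlarged by a suitable endpoint of [e], still dominates once
    [e] is gone. *)
Lemma domination_number_del1 G (e : {set V}) :
  domination_number (del_edges G [set e]) <= (domination_number G).+1.
Proof.
have [eG|eNG] := boolP (e \in edges G); last first.
  have -> : del_edges G [set e] = G; last exact: leqnSn.
  by apply: val_inj; apply/setDidPl; rewrite disjoint_sym disjoints1.
have /cards2P[x [y [_ def_e]]] : #|e| == 2.
  exact: (forall_inP (edges_card2 G)).
have [D domD <-] := domination_number_attained G.
(* Only an endpoint of [e] outside [D] can lose its dominator. *)
pose z := if x \in D then y else x.
apply: (@leq_trans #|z |: D|); last by rewrite cardsU1 -add1n leq_add2r leq_b1.
apply/domination_number_le/forallP => v.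
move: (forallP domD v); rewrite in_setU1; have [//|vNz] := eqVneq v z.
have [//|vND /exists_inP[u uD uv]] := boolP (v \in D).
apply/exists_inP; exists u; first by rewrite in_setU1 uD orbT.
(* If the edge from [u] to [v] were [e], then [v], its endpoint outside [D], would be [z]. *)
rewrite /adj in_setD in_set1 [_ \in _]uv andbT def_e; apply: contra vNz => /eqP uv_xy.
have : x \in [set u; v] by rewrite uv_xy set21.
rewrite /z !inE => /orP[]/eqP def_x; last by rewrite def_x (negPf vND).
have : v \in [set x; y] by rewrite -uv_xy set22.
by rewrite def_x uD !inE => /orP[/eqP def_v|//]; rewrite def_v uD in vND.
Qed.

Lemma domination_number_delD1 G F (e : {set V}) : e \in F ->
  domination_number (del_edges G F)
    <= (domination_number (del_edges G (F :\ e))).+1.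
Proof.
move=> eF; rewrite -[in X in X <= _](setD1K eF) setUC -del_edgesU.
exact: domination_number_del1.
Qed.

Lemma bondage_numberP G b : bondage_number G = Some b <->
  (exists2 F, bondage_set G F & #|F| = b) /\
  (forall F, bondage_set G F -> b <= #|F|).
Proof.
apply: (iff_trans (ominP _ _)); split=> [] [] bF minb; split.
- by case/imageP: bF => F; rewrite inE => FG ->; exists F.
- by move=> F FG; apply: minb; apply/imageP; exists F; rewrite ?inE.
- by case: bF => F FG <-; apply/imageP; exists F; rewrite ?inE.
- by move=> _ /imageP[F + ->]; rewrite inE; apply: minb.
Qed.

(** A single bondage set already rules out the value [None]. *)
Lemma bondage_number_le G F : bondage_set G F ->
  exists2 b, bondage_number G = Some b & b <= #|F|.
Proof.
move=> FG.
have : #|F| \in [seq #|(E : {set {set V}})| | E in [set E | bondage_set G E]].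
  by apply/imageP; exists F; rewrite ?inE.
case def_b: (bondage_number G) => [b|].
  by exists b => //; have /bondage_numberP[_ ->] := def_b.
by move: def_b; rewrite /bondage_number /omin; case: [seq _ | _ in _].
Qed.

(** By minimality, deleting all of [F] but one edge does not raise the domination number, and the
    last edge adds at most one. *)
Lemma domination_number_min_bondage G F : min_bondage_set G F ->
  domination_number (del_edges G F) = (domination_number G).+1.
Proof.
case/andP=> /andP[FG ltF] /eqP/bondage_numberP[_ minF].
apply/eqP; rewrite eqn_leq ltF andbT.
have [F0|[e eF]] := set_0Vmem F; first by rewrite F0 del_edges0 ltnn in ltF.
apply: leq_trans (domination_number_delD1 G eF) _; rewrite ltnS leqNgt.
apply/negP => ltFe; have /minF : bondage_set G (F :\ e).
  by rewrite /bondage_set ltFe (subset_trans (subD1set F e) FG).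
by rewrite [in X in X <= _](cardsD1 e) eF ltnn.
Qed.

Lemma class_bondage_numberP (C : {set sgraph V}) c :
  class_bondage_number C = Some c <->
  (exists2 H, H \in C & bondage_number H = Some c) /\
  (forall H b, H \in C -> bondage_number H = Some b -> c <= b).
Proof.
apply: (iff_trans (ominP _ _)); split=> [] [] cH minc; split.
- move: cH; rewrite mem_pmap => /mapP[H]; rewrite mem_enum => HC Hc.
  by exists H.
- move=> H b HC Hb; apply: minc; rewrite mem_pmap -Hb.
  by rewrite map_f // mem_enum.
- by case: cH => H HC Hc; rewrite mem_pmap -Hc map_f // mem_enum.
- move=> b; rewrite mem_pmap => /mapP[H]; rewrite mem_enum => HC Hb.
  exact: minc HC (esym Hb).
Qed.

End Bondage.

Theorem theorem1 (V : finType) (G : sgraph V) (c : nat) :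
  domination_number G + 2 <= #|V| ->
  class_bondage_number (MB G) = Some c ->
  c <= 2 ->
  exists2 b : nat, bondage_number G = Some b
                 & sync_bondage_number 2 G = Some (b + c).
Proof.
move=> _ /class_bondage_numberP[[H /imsetP[F1]]].
rewrite inE => minF1 -> bH minc c2.
have /andP[/andP[F1G _] /eqP bG] := minF1.
exists #|F1| => //; have /bondage_numberP[_ minb] := bG.
apply/ominP; split.
  have /bondage_numberP[[F2 F2H cardF2] _] := bH.
  have F2min : min_bondage_set (del_edges G F1) F2.
    by rewrite /min_bondage_set F2H bH cardF2 /=.
  have /andP[F2G _] := F2H.
  apply/imageP; exists (F1 :|: F2).
    rewrite inE -del_edgesU (domination_number_min_bondage F2min).
    rewrite (domination_number_min_bondage minF1) addn2 eqxx andbT.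
    by rewrite subUset F1G (subset_trans F2G) ?subsetDl.
  (* [F2] consists of edges that survive the deletion of [F1], so the two sizes add up. *)
  have disF : F1 :&: F2 = set0.
    apply/setP => e; rewrite !inE; apply/negP => /andP[eF1 /(subsetP F2G)].
    by rewrite inE eF1.
  by rewrite cardsU disF cards0 subn0 cardF2.
move=> _ /imageP[F + ->]; rewrite inE => /andP[FG /eqP dnF].
have [F0|[e eF]] := set_0Vmem F.
  by move: dnF; rewrite F0 del_edges0 => /eqP; rewrite -[X in X == _]addn0 eqn_add2l.
have FeG : bondage_set G (F :\ e).
  rewrite /bondage_set (subset_trans (subD1set F e) FG) /=.
  rewrite -ltnS; apply: leq_trans (domination_number_delD1 G eF).
  by rewrite dnF addn2.
have leb := minb _ FeG.
have cardF : #|F| = #|F :\ e|.+1 by rewrite (cardsD1 e) eF.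
(* For [c <= 1] the removed edge [e] alone accounts for [c]. *)
have [c1|c_gt1] := leqP c 1.
  by rewrite cardF -addn1; apply: leq_add.
(* Since [c <= 2], it suffices that [F :\ e] has more than [#|F1|] edges; equality is refuted
   next. *)
rewrite cardF; apply: leq_trans (leq_add (leqnn _) c2) _; rewrite addn2 ltnS.
rewrite ltn_neqAle leb andbT; apply/eqP => eqb.
have minFe : min_bondage_set G (F :\ e) by rewrite /min_bondage_set FeG bG eqb /=.
have HC : del_edges G (F :\ e) \in MB G by apply: imset_f; rewrite inE.
(* Deleting [F :\ e] raises the domination number by one and [F] by two, so [e] causes the second
   increase. *)
have eH : bondage_set (del_edges G (F :\ e)) [set e].
  rewrite /bondage_set sub1set !inE eqxx (subsetP FG) //=.
  rewrite del_edgesU setUC setD1K // dnF.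
  by rewrite (domination_number_min_bondage minFe) addn2.
have [b' /(minc _ _ HC) lecb'] := bondage_number_le eH.
by rewrite cards1 => /(leq_trans lecb'); rewrite leqNgt c_gt1.
Qed.
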